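(* There exist functions $\alpha,\gamma:\mathbb{N}\to\mathbb{N}$ such that for every integer $\ell\ge1$, all $n\le m$ and every $X=(x_1,\dots,x_m)\in[n]^m$, $\mathsf{F}^{\alpha(\ell)}(X)\le \gamma(\ell)\cdot \mathsf{UB}^{\ell}(X)$, where $\mathsf{UB}^{\ell}(X)=\sum_{t=1}^m \min_{t'\in[t-\ell,t),\,t'\ge1}\log\big(|x_t-x_{t'}|+\rho_t(x_{t'})\big)$.
   Context: $\log(x)$ denotes $\log_2(\max\{2,x\})$. $\rho_t(a)$ is the number of distinct keys accessed strictly between the last time $s<t$ with $x_s=a$ and time $t$ (all keys considered accessed at time $0$); the term for $t=1$ (empty range) is interpreted as $\log n$. $k$-finger cost: for a static BST $T$ on $[n]$, $d_T(a,b)$ is the number of edges between $a$ and $b$ in $T$. A $k$-finger strategy is an initial vector $\vec\ell\in[n]^k$ and $\vec f\in[k]^m$, finger $f_t$ serving $x_t$, with cost $\sum_{t=1}^m(1+d_T(x_t,p_t))$ where $p_t$ is the position of finger $f_t$ before time $t$ (its last served key, or $\ell_{f_t}$). $\mathsf{F}^k_T(X)$ is the minimum such cost, $\mathsf{F}^k(X)=\min_T\mathsf{F}^k_T(X)$ over BSTs $T$ on $[n]$. *)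

(* Defs.v *)
From Stdlib Require Import Reals Lra Lia Arith List.
Import ListNotations.
Open Scope R_scope.

Definition log2m (x : R) : R := ln (Rmax 2 x) / ln 2.

Inductive tree : Type :=
| Leaf : tree
| Node : tree -> nat -> tree -> tree.

Fixpoint inorder (T : tree) : list nat :=
  match T with
  | Leaf => []
  | Node l k r => inorder l ++ k :: inorder r
  end.

Definition is_bst_on (T : tree) (n : nat) : Prop := inorder T = seq 1 n.

Fixpoint search_path (T : tree) (a : nat) : list nat :=
  match T with
  | Leaf => []
  | Node l k r =>
      if Nat.eqb a k then [k]
      else if Nat.ltb a k then k :: search_path l a
      else k :: search_path r a
  end.

Fixpoint common_prefix_len (p q : list nat) : nat :=
  match p, q with
  | x :: p', y :: q' => if Nat.eqb x y then S (common_prefix_len p' q') else O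
  | _, _ => O
  end.

Definition tree_dist (T : tree) (a b : nat) : nat :=
  let pa := search_path T a in
  let pb := search_path T b in
  (length pa + length pb - 2 * common_prefix_len pa pb)%nat.

(** x_t, 1-indexed. *)
Definition xt (X : list nat) (t : nat) : nat := nth (t - 1) X 0%nat.

(** Cost of serving the remaining requests xs with finger choices fs,
    given current finger positions pos (finger i at pos i). *)
Fixpoint strat_cost (T : tree) (pos : nat -> nat) (xs fs : list nat) : nat :=
  match xs, fs with
  | x :: xs', f :: fs' =>
      (1 + tree_dist T x (pos f)
       + strat_cost T (fun i => if Nat.eqb i f then x else pos i) xs' fs')%nat
  | _, _ => O
  end.

(** Cost of the k-finger strategy (init = vector l in [n]^k, fs = vector f in [k]^m):
    finger i (1-indexed) starts at nth (i-1) init. *)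
Definition kfinger_cost (T : tree) (init : list nat) (X fs : list nat) : nat :=
  strat_cost T (fun i => nth (i - 1) init 0%nat) X fs.

Definition valid_strategy (n k : nat) (X init fs : list nat) : Prop :=
  length init = k /\ Forall (fun a => 1 <= a <= n)%nat init /\
  length fs = length X /\ Forall (fun f => 1 <= f <= k)%nat fs.

(** "F^k(X) <= c": since F^k(X) = min over BSTs T on [n] and k-finger
    strategies of the cost, F^k(X) <= c iff some T and strategy have cost <= c. *)
Definition Fk_le (k n : nat) (X : list nat) (c : R) : Prop :=
  exists T : tree, is_bst_on T n /\
  exists init fs : list nat, valid_strategy n k X init fs /\
    INR (kfinger_cost T init X fs) <= c.

(** Last time s < t (searching s = t-1 down to 1) with x_s = a; 0 if none
    (every key counts as accessed at time 0). *)
Fixpoint last_access_from (X : list nat) (a s : nat) : nat :=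
  match s with
  | O => O
  | S s' => if Nat.eqb (xt X (S s')) a then S s' else last_access_from X a s'
  end.

Definition last_access (X : list nat) (t a : nat) : nat :=
  last_access_from X a (t - 1).

Definition rho (X : list nat) (t a : nat) : nat :=
  let s := last_access X t a in
  length (nodup Nat.eq_dec (map (xt X) (seq (S s) (t - 1 - s)))).

Definition natdist (a b : nat) : nat := ((a - b) + (b - a))%nat.

Definition ub_term (l n : nat) (X : list nat) (t : nat) : R :=
  let g := fun t' => log2m (INR (natdist (xt X t) (xt X t') + rho X t (xt X t'))) in
  let lo := Nat.max 1 (t - l) in
  match t with
  | O => 0
  | 1%nat => log2m (INR n)
  | _ => fold_left (fun acc t' => Rmin acc (g t')) (seq (S lo) (t - 1 - lo)) (g lo)
  end.

Definition UB (l n : nat) (X : list nat) : R :=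
  fold_right Rplus 0 (map (ub_term l n X) (seq 1 (length X))).

(* Main.v *)
(** Let the parent of request t be a t' in the window [t - l, t) minimising its term of
    UB^l; this makes the requests a tree rooted at the first one, with edge weights
    log |x_t - x_t'|. It suffices to colour the tree with boundedly many colours so that
    each colour class, visited in time order, enters and leaves every subtree at most once:
    with one finger per colour, the moves of a finger then use each tree edge at most twice.

    Decompose the tree into paths, a node being continued by its child whose subtree
    survives longest. Give each new path a digit not seen on the l preceding requests; a path
    that is still alive has a node among these, so paths alive together have distinct digits.
    The colour of a request is the sequence of digits of the paths between it and the root.

    It remains to find one search tree for all finger moves. In a perfect binary tree with
    a uniformly random shift of the keys, two keys at distance d have expected tree distance
    O(1 + log d), and the pairs to be averaged are known before the tree is chosen. *)

Require Import Defs.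
From Stdlib Require Import Reals Lra Lia Arith List.
Import ListNotations.
Open Scope nat_scope.

(** * Shifted dyadic search trees *)

Fixpoint sum_below (n : nat) (f : nat -> nat) : nat :=
  match n with
  | 0 => 0
  | S n' => sum_below n' f + f n'
  end.

Lemma sum_below_le n f g :
  (forall i, i < n -> f i <= g i) -> sum_below n f <= sum_below n g.
Proof.
  induction n as [|n IH]; simpl; intros H; [lia|].
  assert (f n <= g n) by (apply H; lia).
  assert (sum_below n f <= sum_below n g) by (apply IH; intros; apply H; lia).
  lia.
Qed.

Lemma sum_below_ext n f g :
  (forall i, i < n -> f i = g i) -> sum_below n f = sum_below n g.
Proof.
  intros H; apply Nat.le_antisymm; apply sum_below_le; intros i Hi;
    rewrite (H i Hi); lia.
Qed.

Lemma sum_below_add n f g :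
  sum_below n (fun i => f i + g i) = sum_below n f + sum_below n g.
Proof. induction n as [|n IH]; simpl; lia. Qed.

Lemma sum_below_mul_l n c f :
  sum_below n (fun i => c * f i) = c * sum_below n f.
Proof. induction n as [|n IH]; simpl; rewrite ?IH; nia. Qed.

Lemma sum_below_const n c : sum_below n (fun _ => c) = n * c.
Proof. induction n as [|n IH]; simpl; lia. Qed.

Lemma sum_below_swap n m f :
  sum_below n (fun i => sum_below m (fun j => f i j)) =
  sum_below m (fun j => sum_below n (fun i => f i j)).
Proof.
  induction n as [|n IH]; simpl.
  - rewrite sum_below_const; lia.
  - rewrite IH, <- sum_below_add; reflexivity.
Qed.

Lemma sum_below_double n f :
  sum_below (2 * n) f = sum_below n (fun i => f (2 * i) + f (2 * i + 1)).
Proof.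
  induction n as [|n IH]; [reflexivity|].
  replace (2 * S n) with (S (S (2 * n))) by lia.
  cbn [sum_below]. rewrite IH.
  replace (S (2 * n)) with (2 * n + 1) by lia. lia.
Qed.

Lemma sum_below_average n c f :
  0 < n -> sum_below n f <= n * c -> exists i, i < n /\ f i <= c.
Proof.
  intros Hn Hsum.
  assert (D : (exists i, i < n /\ f i <= c) \/ (forall i, i < n -> S c <= f i)).
  { clear. induction n as [|n [(i & ? & ?)|IH]].
    - right; lia.
    - left; exists i; split; [lia|assumption].
    - destruct (le_lt_dec (f n) c).
      + left; exists n; split; [lia|assumption].
      + right; intros i Hi; destruct (Nat.eq_dec i n) as [->|]; [lia|apply IH; lia]. }
  destruct D as [D|D]; [exact D|].
  apply sum_below_le in D. rewrite sum_below_const in D. nia.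
Qed.

(** The length of the binary expansion of [d], an integer form of 1 + log d. Its value 0 at 0 and
    its subadditivity make [bits_dist] a metric. *)
Definition bits (d : nat) : nat :=
  match d with
  | 0 => 0
  | S _ => S (Nat.log2 d)
  end.

Lemma bits_pos d : 0 < d -> bits d = S (Nat.log2 d).
Proof. destruct d; simpl; [lia|reflexivity]. Qed.

Lemma bits_mono a b : a <= b -> bits a <= bits b.
Proof.
  intros H. destruct (Nat.eq_dec a 0) as [->|]; [simpl; lia|].
  rewrite !bits_pos by lia. apply le_n_S, Nat.log2_le_mono, H.
Qed.

Lemma bits_add a b : bits (a + b) <= bits a + bits b.
Proof.
  destruct (Nat.eq_dec a 0) as [->|]; [simpl; lia|].
  destruct (Nat.eq_dec b 0) as [->|]; [rewrite Nat.add_0_r; lia|].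
  rewrite !bits_pos by lia.
  destruct (Nat.eq_dec a 1) as [->|]; [pose proof (Nat.log2_succ_le b); simpl in *; lia|].
  destruct (Nat.eq_dec b 1) as [->|].
  { rewrite Nat.add_1_r. pose proof (Nat.log2_succ_le a); lia. }
  pose proof (Nat.log2_add_le a b). lia.
Qed.

Lemma bits_half d : 0 < d -> bits d = S (bits (d / 2)).
Proof.
  intros Hd. destruct (Nat.eq_dec d 1) as [->|]; [reflexivity|].
  pose proof (Nat.div_mod_eq d 2). pose proof (Nat.mod_upper_bound d 2).
  rewrite !bits_pos by lia. f_equal.
  destruct (Nat.eq_dec (d mod 2) 0).
  - replace d with (2 * (d / 2)) at 1 by lia. apply Nat.log2_double; lia.
  - replace d with (2 * (d / 2) + 1) at 1 by lia. apply Nat.log2_succ_double; lia.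
Qed.

Definition bits_dist (a b : nat) : nat := bits (natdist a b).

Lemma bits_dist_refl a : bits_dist a a = 0.
Proof. unfold bits_dist, natdist; rewrite Nat.sub_diag; reflexivity. Qed.

Lemma bits_dist_sym a b : bits_dist a b = bits_dist b a.
Proof. unfold bits_dist, natdist; f_equal; lia. Qed.

Lemma bits_dist_triangle a b c : bits_dist a c <= bits_dist a b + bits_dist b c.
Proof.
  unfold bits_dist. etransitivity; [|apply bits_add].
  apply bits_mono; unfold natdist; lia.
Qed.

(* In the perfect search tree on the open interval (lo, lo + 2^h), keep the
   positions s + 1, ..., s + n and relabel position s + k as k. *)
Fixpoint dyadic_tree (h lo s n : nat) : tree :=
  match h with
  | 0 => Leaf
  | S h' =>
      let mid := lo + 2 ^ h' in
      if mid <=? s then dyadic_tree h' mid s n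
      else if s + n <? mid then dyadic_tree h' lo s n
      else Node (dyadic_tree h' lo s n) (mid - s) (dyadic_tree h' mid s n)
  end.

(** Truncated subtraction does the clipping: [lo - s] is 0 when the interval starts before the
    window of kept positions, and the minimum with [n] cuts at its right end. *)
Lemma inorder_dyadic_tree h lo s n :
  inorder (dyadic_tree h lo s n) =
  seq (S (lo - s)) (Nat.min n (lo + 2 ^ h - 1 - s) - (lo - s)).
Proof.
  revert lo; induction h as [|h IH]; intros lo.
  - rewrite Nat.pow_0_r. replace (Nat.min _ _ - _) with 0 by lia. reflexivity.
  - cbn [dyadic_tree]. rewrite Nat.pow_succ_r'.
    pose proof (Nat.pow_nonzero 2 h ltac:(lia)).
    destruct (Nat.leb_spec (lo + 2 ^ h) s); [|destruct (Nat.ltb_spec (s + n) (lo + 2 ^ h))].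
    + rewrite IH. f_equal; lia.
    + rewrite IH. f_equal; lia.
    + cbn [inorder]. rewrite !IH.
      set (A := lo - s). set (B := Nat.min n (lo + 2 * 2 ^ h - 1 - s)).
      set (M := lo + 2 ^ h - s).
      replace (Nat.min n (lo + 2 ^ h - 1 - s) - A) with (M - 1 - A) by lia.
      replace (Nat.min n (lo + 2 ^ h + 2 ^ h - 1 - s)) with B by (unfold B; f_equal; lia).
      assert (A < M) by (subst A M; lia).
      destruct (le_lt_dec M B); [|subst B M; lia].
      replace (B - A) with ((M - 1 - A) + S (B - M)) by lia.
      rewrite seq_app. cbn [seq]. repeat f_equal; lia.
Qed.

(** Height h + 1 gives 2^(h+1) - 1 positions, enough for the window s + 1, ..., s + n under every
    shift s < 2^h. *)
Lemma dyadic_tree_bst h s n : s < 2 ^ h -> n <= 2 ^ h -> is_bst_on (dyadic_tree (S h) 0 s n) n.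
Proof.
  intros Hs Hn. unfold is_bst_on. rewrite inorder_dyadic_tree.
  pose proof (Nat.pow_succ_r' 2 h). f_equal; lia.
Qed.

Lemma length_search_path_dyadic_tree h lo s n a :
  length (search_path (dyadic_tree h lo s n) a) <= h.
Proof.
  revert lo; induction h as [|h IH]; intros lo; cbn [dyadic_tree]; [simpl; lia|].
  pose proof (IH lo). pose proof (IH (lo + 2 ^ h)).
  destruct (_ <=? _); [lia|]. destruct (_ <? _); [lia|].
  cbn [search_path]. destruct (_ =? _); [simpl; lia|].
  destruct (_ <? _); simpl; lia.
Qed.

Lemma tree_dist_left l k r a b : a < k -> b < k -> tree_dist (Node l k r) a b = tree_dist l a b.
Proof.
  intros Ha Hb. unfold tree_dist. cbn [search_path].
  rewrite (proj2 (Nat.eqb_neq a k)), (proj2 (Nat.eqb_neq b k)) by lia.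
  rewrite (proj2 (Nat.ltb_lt a k)), (proj2 (Nat.ltb_lt b k)) by lia.
  cbn [length common_prefix_len]. rewrite Nat.eqb_refl. lia.
Qed.

Lemma tree_dist_right l k r a b : k < a -> k < b -> tree_dist (Node l k r) a b = tree_dist r a b.
Proof.
  intros Ha Hb. unfold tree_dist. cbn [search_path].
  rewrite (proj2 (Nat.eqb_neq a k)), (proj2 (Nat.eqb_neq b k)) by lia.
  rewrite (proj2 (Nat.ltb_ge a k)), (proj2 (Nat.ltb_ge b k)) by lia.
  cbn [length common_prefix_len]. rewrite Nat.eqb_refl. lia.
Qed.

(* Both search paths stay together down to height j, since no separating root is a
   multiple of 2^j. *)
Lemma tree_dist_dyadic_tree j h q s n a b :
  1 <= a <= n -> 1 <= b <= n ->
  h <= j \/ (forall i, ~ (Nat.min a b + s <= i * 2 ^ j <= Nat.max a b + s)) ->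
  tree_dist (dyadic_tree h (q * 2 ^ h) s n) a b <= 2 * j.
Proof.
  intros Ha Hb Hj. revert q; induction h as [|h IH]; intros q; [unfold tree_dist; simpl; lia|].
  destruct (le_lt_dec (S h) j) as [Hle|Hlt].
  - pose proof (length_search_path_dyadic_tree (S h) (q * 2 ^ S h) s n a).
    pose proof (length_search_path_dyadic_tree (S h) (q * 2 ^ S h) s n b).
    unfold tree_dist. lia.
  - destruct Hj as [Hj|Hj]; [lia|]. cbn [dyadic_tree].
    assert (E : q * 2 ^ S h = 2 * q * 2 ^ h) by (rewrite Nat.pow_succ_r'; lia).
    assert (E' : q * 2 ^ S h + 2 ^ h = (2 * q + 1) * 2 ^ h) by (rewrite E; lia).
    destruct (Nat.leb_spec (q * 2 ^ S h + 2 ^ h) s);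
      [|destruct (Nat.ltb_spec (s + n) (q * 2 ^ S h + 2 ^ h))].
    + rewrite E'; apply IH; right; exact Hj.
    + rewrite E; apply IH; right; exact Hj.
    (* The root is an odd multiple of 2^h with j <= h, hence a multiple of 2^j; it does not lie
       between the two keys, so both searches go to the same side. *)
    + assert (Hmid : exists i, q * 2 ^ S h + 2 ^ h = i * 2 ^ j).
      { exists ((2 * q + 1) * 2 ^ (h - j)). rewrite E'.
        replace h with (h - j + j) at 1 by lia. rewrite Nat.pow_add_r; lia. }
      destruct Hmid as [i Hi]. pose proof (Hj i) as Hji. rewrite <- Hi in Hji.
      destruct (le_lt_dec (q * 2 ^ S h + 2 ^ h) (Nat.min a b + s)).
      * rewrite tree_dist_right by lia. rewrite E'; apply IH; right; exact Hj.
      * rewrite tree_dist_left by lia. rewrite E; apply IH; right; exact Hj.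
Qed.

(* The least j < h such that [a, b] contains no multiple of 2^(j+1), or h if there is none. *)
Fixpoint dyadic_level (h a b : nat) : nat :=
  match h with
  | 0 => 0
  | S h' => if ((a =? b) && Nat.odd a)%bool then 0 else S (dyadic_level h' ((a + 1) / 2) (b / 2))
  end.

(** The even numbers in [a, b] are the doubles of the integers in [(a + 1) / 2, b / 2], so each
    halving removes one factor 2. *)
Lemma dyadic_level_spec h a b : a <= b ->
  dyadic_level h a b = h \/ forall i, ~ (a <= i * 2 ^ S (dyadic_level h a b) <= b).
Proof.
  revert a b; induction h as [|h IH]; intros a b Hab; [left; reflexivity|].
  cbn [dyadic_level].
  destruct ((a =? b) && Nat.odd a)%bool eqn:E.
  - right. apply andb_prop in E. destruct E as [E1 E2].
    apply Nat.eqb_eq in E1. apply Nat.odd_spec in E2. destruct E2 as [c Hc].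
    intros i. simpl. lia.
  - assert (Hab' : (a + 1) / 2 <= b / 2).
    { destruct (Nat.eq_dec a b) as [->|].
      - rewrite Nat.eqb_refl in E. cbn [andb] in E.
        rewrite <- Nat.negb_even in E. apply Bool.negb_false_iff, Nat.even_spec in E.
        destruct E as [c ->].
        replace (2 * c + 1) with (1 + c * 2) by lia. rewrite Nat.div_add by lia.
        replace (2 * c) with (c * 2) by lia. rewrite Nat.div_mul by lia. simpl; lia.
      - apply Nat.Div0.div_le_mono; lia. }
    destruct (IH _ _ Hab') as [->|H]; [left; reflexivity|right].
    intros i Hi. apply (H i). rewrite Nat.pow_succ_r' in Hi.
    pose proof (Nat.div_mod_eq (a + 1) 2). pose proof (Nat.mod_upper_bound (a + 1) 2).
    pose proof (Nat.div_mod_eq b 2). pose proof (Nat.mod_upper_bound b 2). lia.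
Qed.

Lemma tree_dist_dyadic_level h s n a b :
  1 <= a <= n -> 1 <= b <= n ->
  tree_dist (dyadic_tree (S h) 0 s n) a b
  <= 2 * S (dyadic_level h (Nat.min a b + s) (Nat.max a b + s)).
Proof.
  intros Ha Hb. apply (tree_dist_dyadic_tree _ (S h) 0); [exact Ha|exact Hb|].
  destruct (dyadic_level_spec h (Nat.min a b + s) (Nat.max a b + s)) as [->|H]; [lia| |].
  - left; lia.
  - right; exact H.
Qed.

Lemma half_double_add a s r : (a + (2 * s + r)) / 2 = (a + r) / 2 + s.
Proof.
  replace (a + (2 * s + r)) with (a + r + s * 2) by lia. apply Nat.div_add; lia.
Qed.

(** Pair the shifts 2s and 2s + 1: halving turns both into instances at height h with shift s. If a
    = b, one of them stops at level 0 and the other recurses; if a < b, both intervals shrink to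
    length at most (b - a) / 2, which uses up one unit of [bits]. *)
Lemma sum_dyadic_level h a b : a <= b ->
  sum_below (2 ^ h) (fun s => dyadic_level h (a + s) (b + s)) <= 2 ^ h * S (bits (b - a)).
Proof.
  revert a b; induction h as [|h IH]; intros a b Hab; [simpl; lia|].
  rewrite Nat.pow_succ_r', sum_below_double. cbn [dyadic_level].
  assert (Hsum : forall f g,
    (forall s, s < 2 ^ h -> f s <= g s) -> sum_below (2 ^ h) f <= sum_below (2 ^ h) g)
    by (intros; apply sum_below_le; assumption).
  destruct (Nat.eq_dec a b) as [<-|Hne].
  - rewrite Nat.sub_diag. cbn [bits].
    (* Exactly one of a + 2s and a + 2s + 1 is even, and its half is c + s. *)
    set (c := (a + 1) / 2).
    etransitivity; [apply (Hsum _ (fun s => 1 + dyadic_level h (c + s) (c + s)))|].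
    + intros s _. rewrite !Nat.eqb_refl. cbn [andb].
      replace (a + 2 * s + 1) with (a + (2 * s + 1)) by lia.
      replace (a + (2 * s + 1) + 1) with (a + 1 + (2 * s + 1)) by lia.
      rewrite !half_double_add.
      assert (Hodd : Nat.odd (a + (2 * s + 1)) = negb (Nat.odd (a + 2 * s))).
      { replace (a + (2 * s + 1)) with (S (a + 2 * s)) by lia.
        rewrite Nat.odd_succ, <- Nat.negb_odd; reflexivity. }
      rewrite Hodd. destruct (Nat.odd (a + 2 * s)) eqn:E; cbn [negb].
      * apply Nat.odd_spec in E as [d Hd].
        replace ((a + 1 + 1) / 2) with c; [fold c; lia|].
        subst c.
        replace (a + 1) with (0 + (d - s + 1) * 2) by lia.
        replace (0 + (d - s + 1) * 2 + 1) with (1 + (d - s + 1) * 2) by lia.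
        rewrite !Nat.div_add by lia. reflexivity.
      * rewrite <- Nat.negb_even in E. apply Bool.negb_false_iff, Nat.even_spec in E as [d Hd].
        replace (a + 2 * s) with (a + (2 * s + 0)) by lia.
        rewrite half_double_add, !Nat.add_0_r.
        replace (a / 2) with c; [fold c; lia|].
        subst c.
        replace a with (0 + (d - s) * 2) by lia.
        replace (0 + (d - s) * 2 + 1) with (1 + (d - s) * 2) by lia.
        rewrite !Nat.div_add by lia. reflexivity.
    + rewrite sum_below_add, sum_below_const. specialize (IH c c ltac:(lia)).
      rewrite Nat.sub_diag in IH. cbn [bits] in IH. lia.
  - etransitivity; [apply (Hsum _ (fun s =>
      2 + (dyadic_level h ((a + 1) / 2 + s) (b / 2 + s)
           + dyadic_level h ((a + 2) / 2 + s) ((b + 1) / 2 + s))))|].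
    + intros s _.
      rewrite !(proj2 (Nat.eqb_neq _ _)) by lia. cbn [andb].
      replace (a + 2 * s + 1) with (a + (2 * s + 1)) by lia.
      replace (a + (2 * s + 1) + 1) with (a + (2 * s + 2)) by lia.
      replace (b + 2 * s) with (b + (2 * s + 0)) by lia.
      rewrite !half_double_add, Nat.add_0_r. lia.
    + rewrite !sum_below_add, sum_below_const.
      pose proof (IH ((a + 1) / 2) (b / 2)) as I1.
      pose proof (IH ((a + 2) / 2) ((b + 1) / 2)) as I2.
      assert (Hd : bits (b - a) = S (bits ((b - a) / 2))) by (apply bits_half; lia).
      assert (M1 : (a + 1) / 2 <= b / 2) by (apply Nat.Div0.div_le_mono; lia).
      assert (M2 : (a + 2) / 2 <= (b + 1) / 2) by (apply Nat.Div0.div_le_mono; lia).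
      assert (D1 : bits (b / 2 - (a + 1) / 2) <= bits ((b - a) / 2)).
      { apply bits_mono.
        pose proof (Nat.div_mod_eq b 2). pose proof (Nat.mod_upper_bound b 2).
        pose proof (Nat.div_mod_eq (a + 1) 2). pose proof (Nat.mod_upper_bound (a + 1) 2).
        pose proof (Nat.div_mod_eq (b - a) 2). pose proof (Nat.mod_upper_bound (b - a) 2).
        lia. }
      assert (D2 : bits ((b + 1) / 2 - (a + 2) / 2) <= bits ((b - a) / 2)).
      { apply bits_mono.
        pose proof (Nat.div_mod_eq (b + 1) 2). pose proof (Nat.mod_upper_bound (b + 1) 2).
        pose proof (Nat.div_mod_eq (a + 2) 2). pose proof (Nat.mod_upper_bound (a + 2) 2).
        pose proof (Nat.div_mod_eq (b - a) 2). pose proof (Nat.mod_upper_bound (b - a) 2).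
        lia. }
      specialize (I1 M1). specialize (I2 M2). nia.
Qed.

(** First-moment argument over the 2^n shifts: the average total level is at most the total of 1 +
    [bits_dist], so a single shift meets this bound for the whole sum. *)
Lemma exists_tree_for_pairs n m (u v : nat -> nat) :
  (forall i, i < m -> 1 <= u i <= n /\ 1 <= v i <= n) ->
  exists T, is_bst_on T n /\
    sum_below m (fun i => 1 + tree_dist T (u i) (v i))
    <= sum_below m (fun i => 5 + 2 * bits_dist (u i) (v i)).
Proof.
  intros Huv.
  set (lev s i := dyadic_level n (Nat.min (u i) (v i) + s) (Nat.max (u i) (v i) + s)).
  destruct (sum_below_average (2 ^ n) (sum_below m (fun i => S (bits_dist (u i) (v i))))
              (fun s => sum_below m (lev s))) as (s & Hs & Hle).
  - pose proof (Nat.pow_nonzero 2 n); lia.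
  - rewrite sum_below_swap, <- sum_below_mul_l. apply sum_below_le. intros i _.
    unfold bits_dist. replace (natdist (u i) (v i)) with (Nat.max (u i) (v i) - Nat.min (u i) (v i))
      by (unfold natdist; lia).
    apply sum_dyadic_level; lia.
  - exists (dyadic_tree (S n) 0 s n). split.
    + apply dyadic_tree_bst; [exact Hs|].
      pose proof (Nat.pow_gt_lin_r 2 n); lia.
    (* A pair costs at most 1 + 2 (1 + level); bounding the total level by the total of 1 +
       [bits_dist] turns the 3 into 5. *)
    + etransitivity; [apply sum_below_le with (g := fun i => 3 + 2 * lev s i)|].
      * intros i Hi. destruct (Huv i Hi).
        pose proof (tree_dist_dyadic_level n s n (u i) (v i)). subst lev; cbn beta. lia.
      * rewrite !sum_below_add, !sum_below_mul_l, !sum_below_const.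
        change (fun i => S (bits_dist (u i) (v i))) with (fun i => 1 + bits_dist (u i) (v i)) in Hle.
        rewrite sum_below_add, sum_below_const in Hle. lia.
Qed.

(** * Colouring the tree of requests *)

(** Course-of-values recursion: stage k tabulates the values below k, with [d] elsewhere, so that
    [F] may consult every smaller argument. *)
Fixpoint strong_rec_table {A : Type} (F : nat -> (nat -> A) -> A) (d : A) (k : nat) : nat -> A :=
  match k with
  | 0 => fun _ => d
  | S k' => fun i => if i =? k' then F k' (strong_rec_table F d k') else strong_rec_table F d k' i
  end.

Definition strong_rec {A : Type} (F : nat -> (nat -> A) -> A) (d : A) (t : nat) : A :=
  strong_rec_table F d (S t) t.

Lemma strong_rec_eq {A : Type} (F : nat -> (nat -> A) -> A) d :
  (forall t f g, (forall i, i < t -> f i = g i) -> F t f = F t g) ->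
  forall t, strong_rec F d t = F t (strong_rec F d).
Proof.
  intros HF t. unfold strong_rec at 1. cbn [strong_rec_table]. rewrite Nat.eqb_refl.
  apply HF. intros i Hi. induction t as [|t IH]; [lia|].
  unfold strong_rec. cbn [strong_rec_table].
  destruct (Nat.eqb_spec i t) as [->|]; [rewrite Nat.eqb_refl; reflexivity|].
  rewrite IH by lia. reflexivity.
Qed.

Definition fresh (L : list nat) : nat :=
  match find (fun y => if in_dec Nat.eq_dec y L then false else true) (seq 0 (S (length L))) with
  | Some y => y
  | None => 0
  end.

(** Pigeonhole on the [length L + 1] candidates: the search never fails. *)
Lemma fresh_spec L : ~ In (fresh L) L /\ fresh L <= length L.
Proof.
  unfold fresh.
  destruct (find _ _) as [y|] eqn:E.
  - apply find_some in E as [Hy E]. apply in_seq in Hy.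
    destruct (in_dec _ y L); [discriminate|]. split; [assumption|lia].
  - exfalso.
    assert (Hincl : incl (seq 0 (S (length L))) L).
    { intros y Hy. apply (find_none _ _ E) in Hy. destruct (in_dec _ y L); [assumption|discriminate]. }
    apply NoDup_incl_length in Hincl; [|apply seq_NoDup].
    rewrite length_seq in Hincl. lia.
Qed.

(** Base-B numerals with entries shifted by one; as no digit is 0, lists of different lengths get
    different codes. *)
Fixpoint encode (B : nat) (L : list nat) : nat :=
  match L with
  | [] => 0
  | x :: L' => S x + B * encode B L'
  end.

Lemma encode_lt B L : Forall (fun x => S x < B) L -> encode B L < B ^ length L.
Proof.
  induction 1 as [|x L Hx _ IH]; cbn [encode length]; [simpl; lia|].
  rewrite Nat.pow_succ_r'. nia.
Qed.

Lemma encode_inj B L L' :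
  Forall (fun x => S x < B) L -> Forall (fun x => S x < B) L' ->
  encode B L = encode B L' -> L = L'.
Proof.
  intros HL; revert L'; induction HL as [|x L Hx _ IH]; intros L' HL' E;
    destruct HL' as [|y L' Hy HL']; cbn [encode] in E; try lia; [reflexivity|].
  assert (encode B L = encode B L') by nia.
  f_equal; [nia|apply IH; assumption].
Qed.

(* [ancestor p v u]: v lies on the path u, p u, p (p u), ... down to the root 0. *)
Definition ancestor (p : nat -> nat) (v u : nat) : bool :=
  strong_rec (fun t f v => match t with 0 => v =? 0 | S _ => ((v =? t) || f (p t) v)%bool end)
    (fun _ => false) u v.

(** Node t stands for request t + 1, so the root 0 is the first request. *)
Definition parent_within (l : nat) (p : nat -> nat) : Prop :=
  forall t, 0 < t -> p t < t <= p t + l.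

Section RequestTree.

Context (l N : nat) (p : nat -> nat) (Hp : parent_within l p).

Local Notation anc v u := (ancestor p v u = true).

Lemma ancestor_eq v u :
  ancestor p v u = match u with 0 => v =? 0 | S _ => ((v =? u) || ancestor p v (p u))%bool end.
Proof.
  unfold ancestor. rewrite strong_rec_eq.
  - destruct u; reflexivity.
  - intros [|t] f g H; [reflexivity|]. rewrite H; [reflexivity|]. apply Hp; lia.
Qed.

Lemma ancestor_refl v : anc v v.
Proof. rewrite ancestor_eq; destruct v; rewrite Nat.eqb_refl; reflexivity. Qed.

Lemma ancestor_parent v u : 0 < u -> v <> u -> ancestor p v u = ancestor p v (p u).
Proof.
  intros Hu Hv. rewrite (ancestor_eq v u). destruct u; [lia|].
  rewrite (proj2 (Nat.eqb_neq _ _) Hv). reflexivity.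
Qed.

Lemma ancestor_inv v u : anc v u -> v = u \/ 0 < u /\ anc v (p u).
Proof.
  intros H. destruct (Nat.eq_dec v u) as [|Hne]; [left; assumption|right].
  destruct (Nat.eq_dec u 0) as [->|].
  - rewrite ancestor_eq in H. apply Nat.eqb_eq in H. lia.
  - rewrite ancestor_parent in H by lia. split; [lia|assumption].
Qed.

Lemma ancestor_le v u : anc v u -> v <= u.
Proof.
  induction u as [u IH] using lt_wf_ind. intros H.
  destruct (ancestor_inv v u H) as [->|[Hu H']]; [lia|].
  pose proof (Hp u Hu). specialize (IH (p u) ltac:(lia) H'). lia.
Qed.

Lemma ancestor_step v u : 0 < u -> anc v (p u) -> anc v u.
Proof.
  intros Hu H. pose proof (ancestor_le _ _ H). pose proof (Hp u Hu).
  rewrite ancestor_parent by lia. exact H.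
Qed.

Lemma ancestor_trans u v w : anc u v -> anc v w -> anc u w.
Proof.
  intros Huv. induction w as [w IH] using lt_wf_ind. intros Hvw.
  destruct (ancestor_inv v w Hvw) as [->|[Hw H]]; [assumption|].
  apply ancestor_step; [assumption|]. apply IH; [apply Hp; assumption|assumption].
Qed.

Lemma ancestor_child q t : anc q t -> q <> t -> exists y, 0 < y /\ p y = q /\ anc y t.
Proof.
  induction t as [t IH] using lt_wf_ind. intros H Hne.
  destruct (ancestor_inv q t H) as [|[Ht H']]; [contradiction|].
  destruct (Nat.eq_dec q (p t)) as [->|Hq].
  - exists t. split; [assumption|split; [reflexivity|apply ancestor_refl]].
  - destruct (IH (p t)) as (y & Hy & Hpy & Hyt); [apply Hp; assumption|assumption|assumption|].
    exists y. split; [assumption|split; [assumption|]]. apply ancestor_step; assumption.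
Qed.

(** If one sibling were strictly above the other, it would be an ancestor of its own parent, which
    has a smaller index. *)
Lemma ancestor_siblings y z e :
  0 < y -> 0 < z -> p y = p z -> anc y e -> anc z e -> y = z.
Proof.
  intros Hy Hz Hyz. pose proof (Hp y Hy). pose proof (Hp z Hz).
  induction e as [e IH] using lt_wf_ind. intros Hye Hze.
  destruct (ancestor_inv y e Hye) as [->|[He Hye']];
    destruct (ancestor_inv z e Hze) as [->|[He' Hze']]; [reflexivity| | |].
  - apply ancestor_le in Hze'. lia.
  - apply ancestor_le in Hye'. lia.
  - apply (IH (p e)); [apply Hp; assumption|assumption|assumption].
Qed.

(** The time until which the subtree of [v] survives. For v <= N the default 0 is reached only when
    v = N = 0, where it is correct. *)
Fixpoint last_descendant_below (k v : nat) : nat :=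
  match k with
  | 0 => 0
  | S k' => if ancestor p v k then k else last_descendant_below k' v
  end.

Definition last_descendant (v : nat) : nat := last_descendant_below N v.

Local Notation last v := (last_descendant v).

Lemma last_ge v u : anc v u -> u <= N -> u <= last v.
Proof.
  unfold last_descendant. intros H Hu. induction N as [|k IH]; [lia|].
  cbn [last_descendant_below].
  destruct (ancestor p v (S k)) eqn:E; [lia|].
  apply IH. destruct (Nat.eq_dec u (S k)) as [->|]; [congruence|lia].
Qed.

Lemma last_le v : last v <= N.
Proof.
  unfold last_descendant. induction N as [|k IH]; cbn [last_descendant_below]; [lia|].
  destruct (ancestor p v (S k)); lia.
Qed.

Lemma ancestor_last v : v <= N -> anc v (last v).
Proof.
  unfold last_descendant. induction N as [|k IH]; cbn [last_descendant_below]; intros Hv.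
  - replace v with 0 by lia. apply ancestor_refl.
  - destruct (ancestor p v (S k)) eqn:E; [assumption|].
    apply IH. destruct (Nat.eq_dec v (S k)) as [->|]; [|lia].
    rewrite ancestor_refl in E; discriminate.
Qed.

Lemma last_antimono u v : v <= N -> anc u v -> last v <= last u.
Proof.
  intros Hv H. apply last_ge; [|apply last_le].
  apply (ancestor_trans _ v); [assumption|apply ancestor_last; assumption].
Qed.

(* The non-root nodes that do not start a new path of the decomposition of the tree into
   the paths {u | last u = e}. *)
Definition heavy (t : nat) : bool := last t =? last (p t).

Definition digit (t : nat) : nat :=
  strong_rec (fun t f =>
    match t with
    | 0 => 0
    | S _ => if heavy t then f (p t) else fresh (map f (seq (t - l) (t - (t - l))))
    end) 0 t.

Lemma digit_eq t :
  digit t = match t with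
            | 0 => 0
            | S _ => if heavy t then digit (p t)
                     else fresh (map digit (seq (t - l) (t - (t - l))))
            end.
Proof.
  unfold digit at 1. rewrite strong_rec_eq; [destruct t; reflexivity|].
  intros [|k] f g H; [reflexivity|].
  destruct (heavy (S k)); [apply H, Hp; lia|].
  f_equal. apply map_ext_in. intros a Ha. apply in_seq in Ha. apply H. lia.
Qed.

(** A window holds at most l requests, so [fresh] finds a digit among 0, ..., l. *)
Lemma digit_le t : digit t <= l.
Proof.
  induction t as [t IH] using lt_wf_ind. rewrite digit_eq.
  destruct t as [|k]; [lia|].
  destruct (heavy (S k)); [apply IH, Hp; lia|].
  destruct (fresh_spec (map digit (seq (S k - l) (S k - (S k - l))))) as [_ H].
  rewrite length_map, length_seq in H. lia.
Qed.

Lemma digit_heavy t : 0 < t -> heavy t = true -> digit t = digit (p t).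
Proof. intros Ht H. rewrite digit_eq. destruct t; [lia|]. rewrite H. reflexivity. Qed.

Lemma digit_start t u :
  0 < t -> heavy t = false -> u < t -> t <= u + l -> digit u <> digit t.
Proof.
  intros Ht H Hu1 Hu2 E. rewrite (digit_eq t) in E. destruct t as [|k]; [lia|].
  rewrite H in E.
  destruct (fresh_spec (map digit (seq (S k - l) (S k - (S k - l))))) as [F _].
  apply F. rewrite <- E. apply in_map, in_seq. lia.
Qed.

(* Walking up the path of s from its end, one meets a node in [t - l, t). *)
Lemma last_of_same_digit s t :
  0 < t -> heavy t = false -> s < t -> t <= N -> digit s = digit t -> last s + l < t.
Proof.
  intros Ht Hheavy Hst HtN Hdig.
  destruct (le_lt_dec t (last s + l)) as [Hle|]; [exfalso|assumption].
  (* [last] can only decrease going down, so it is constant between s and u; all these steps are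
     heavy and inherit the digit. *)
  assert (Hpath : forall u, u <= N -> anc s u -> last u = last s -> digit u = digit s).
  { induction u as [u IH] using lt_wf_ind. intros HuN Hu Hlast.
    destruct (ancestor_inv s u Hu) as [->|[Hu0 Hsu]]; [reflexivity|].
    pose proof (Hp u Hu0).
    assert (last u <= last (p u)) by (apply last_antimono; [lia|]; apply ancestor_step, ancestor_refl; lia).
    assert (last (p u) <= last s) by (apply last_antimono; [lia|assumption]).
    rewrite digit_heavy; [apply IH; [lia|lia|assumption|lia]|assumption|].
    apply Nat.eqb_eq; lia. }
  (* A step to the parent goes back at most l, so from a node at or after t it cannot jump over the
     window [t - l, t). A path node inside the window has the digit of s, contradicting freshness at
     t. *)
  assert (Hwalk : forall u, u <= N -> anc s u -> last u = last s -> t <= u + l -> False).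
  { induction u as [u IH] using lt_wf_ind. intros HuN Hu Hlast Htu.
    destruct (le_lt_dec t u).
    - destruct (ancestor_inv s u Hu) as [->|[Hu0 Hsu]]; [lia|].
      pose proof (Hp u Hu0).
      assert (last u <= last (p u)) by (apply last_antimono; [lia|]; apply ancestor_step, ancestor_refl; lia).
      assert (last (p u) <= last s) by (apply last_antimono; [lia|assumption]).
      apply (IH (p u)); try lia; assumption.
    - apply (digit_start t u); try assumption.
      rewrite (Hpath u); assumption. }
  assert (s <= N) by lia.
  pose proof (ancestor_last s ltac:(lia)). pose proof (last_le s).
  apply (Hwalk (last s)); try assumption.
  apply Nat.le_antisymm.
  - apply last_antimono; assumption.
  - apply last_ge; [apply ancestor_refl|assumption].
Qed.

(* The colour of t; the digit of the innermost path comes first. *)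
Definition digits (t : nat) : list nat :=
  strong_rec (fun t f =>
    match t with
    | 0 => []
    | S _ => if heavy t then f (p t) else digit t :: f (p t)
    end) [] t.

Lemma digits_eq t :
  digits t = match t with
             | 0 => []
             | S _ => if heavy t then digits (p t) else digit t :: digits (p t)
             end.
Proof.
  unfold digits at 1. rewrite strong_rec_eq; [destruct t; reflexivity|].
  intros [|k] f g H; [reflexivity|].
  rewrite (H (p (S k))); [reflexivity|]. apply Hp; lia.
Qed.

Lemma digits_heavy t : 0 < t -> heavy t = true -> digits t = digits (p t).
Proof. intros Ht H. rewrite digits_eq. destruct t; [lia|]. rewrite H. reflexivity. Qed.

Lemma digits_start t : 0 < t -> heavy t = false -> digits t = digit t :: digits (p t).
Proof. intros Ht H. rewrite digits_eq. destruct t; [lia|]. rewrite H. reflexivity. Qed.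

Lemma length_digits_mono v u : anc v u -> length (digits v) <= length (digits u).
Proof.
  induction u as [u IH] using lt_wf_ind. intros H.
  destruct (ancestor_inv v u H) as [->|[Hu H']]; [lia|].
  specialize (IH (p u) (proj1 (Hp u Hu)) H').
  destruct (heavy u) eqn:E.
  - rewrite (digits_heavy u); assumption.
  - rewrite (digits_start u) by assumption. simpl; lia.
Qed.

Lemma digits_ancestor t x : In x (digits t) -> exists v, anc v t /\ digit v = x.
Proof.
  induction t as [t IH] using lt_wf_ind. intros H.
  destruct (Nat.eq_dec t 0) as [->|]; [rewrite digits_eq in H; destruct H|].
  pose proof (Hp t ltac:(lia)).
  assert (Hrec : In x (digits (p t)) -> exists v, anc v t /\ digit v = x).
  { intros H'. destruct (IH (p t) ltac:(lia) H') as (v & Hv & Ex).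
    exists v. split; [apply ancestor_step; [lia|assumption]|assumption]. }
  destruct (heavy t) eqn:E.
  - rewrite (digits_heavy t) in H by (lia || assumption). apply Hrec, H.
  - rewrite (digits_start t) in H by (lia || assumption).
    destruct H as [<-|H]; [exists t; split; [apply ancestor_refl|reflexivity]|apply Hrec, H].
Qed.

(** If the digit of a new path at t already occurred at an ancestor v, the subtree of v would have
    died before t, yet it contains t. *)
Lemma digits_NoDup t : t <= N -> NoDup (digits t).
Proof.
  induction t as [t IH] using lt_wf_ind. intros HtN.
  destruct (Nat.eq_dec t 0) as [->|]; [rewrite digits_eq; constructor|].
  pose proof (Hp t ltac:(lia)).
  destruct (heavy t) eqn:E.
  - rewrite (digits_heavy t) by (lia || assumption). apply IH; lia.
  - rewrite (digits_start t) by (lia || assumption). constructor; [|apply IH; lia].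
    intros Hin. apply digits_ancestor in Hin as (v & Hv & Hd).
    pose proof (ancestor_le _ _ Hv).
    pose proof (last_of_same_digit v t ltac:(lia) E ltac:(lia) HtN Hd).
    pose proof (last_ge v t (ancestor_step v t ltac:(lia) Hv) HtN). lia.
Qed.

Lemma digits_bound t : Forall (fun x => x <= l) (digits t).
Proof.
  apply Forall_forall. intros x Hx. apply digits_ancestor in Hx as (v & _ & <-). apply digit_le.
Qed.

(** Distinct digits from 0, ..., l number at most l + 1; this bounds the depth of nested paths. *)
Lemma length_digits t : t <= N -> length (digits t) <= S l.
Proof.
  intros Ht. rewrite <- (length_seq (S l) 0).
  apply NoDup_incl_length; [apply digits_NoDup, Ht|].
  intros x Hx. apply in_seq.
  pose proof (proj1 (Forall_forall _ _) (digits_bound t) x Hx). simpl in *; lia.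
Qed.

(* Below q, leaving the path of q means entering a new path, which adds a digit. *)
Lemma digits_off_path q s t :
  0 < s -> p s = q -> heavy s = true -> s <= N -> t <= N ->
  anc q t -> q <> t -> digits t = digits q -> anc s t.
Proof.
  intros Hs Hq Hheavy HsN HtN Hqt Hne Hdig.
  destruct (ancestor_child q t Hqt Hne) as (y & Hy & Hpy & Hyt).
  pose proof (ancestor_le _ _ Hyt).
  destruct (heavy y) eqn:E.
  - apply Nat.eqb_eq in E. apply Nat.eqb_eq in Hheavy.
    replace s with y; [assumption|].
    (* Two heavy children of q would both have [last q] as a descendant. *)
    apply (ancestor_siblings y s (last q)); [assumption|assumption|congruence| |].
    + rewrite <- Hpy, <- E. apply ancestor_last; lia.
    + rewrite <- Hq, <- Hheavy. apply ancestor_last; lia.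
  - pose proof (length_digits_mono y t Hyt) as L.
    rewrite (digits_start y), Hpy, Hdig in L by assumption. simpl in L; lia.
Qed.

(** The core of convexity: a request with the colour of a member of a subtree that is still alive
    belongs to it. Induction on s + t moves s or t to its parent; the condition [t <= last v] stands
    in for a later descendant of v and survives these moves. *)
Lemma ancestor_of_same_digits s t v :
  s <= t -> t <= N -> digits s = digits t -> anc v s -> t <= last v -> anc v t.
Proof.
  remember (s + t) as k eqn:Hk. revert s t v Hk.
  induction k as [k IH] using lt_wf_ind. intros s t v -> Hst HtN Hdig Hvs Hlast.
  destruct (Nat.eq_dec s t) as [->|Hne]; [assumption|].
  assert (Ht : 0 < t) by lia. pose proof (Hp t Ht) as Hpt.
  destruct (heavy t) eqn:Et.
  - rewrite (digits_heavy t) in Hdig by assumption.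
    destruct (le_lt_dec s (p t)).
    + apply ancestor_step; [assumption|].
      apply (IH (s + p t) ltac:(lia) s); try lia; assumption.
    (* Here p t < s < t. By induction s lies below p t; having the same digits as p t, it lies below
       the heavy child t, although s < t. *)
    + exfalso.
      assert (Hs : anc (p t) s).
      { apply (IH (p t + s) ltac:(lia) (p t)); try lia; [congruence|apply ancestor_refl|].
        pose proof (last_ge (p t) t (ancestor_step _ _ Ht (ancestor_refl _)) HtN). lia. }
      assert (Hts : anc t s) by (apply (digits_off_path (p t)); try assumption; try reflexivity; lia).
      apply ancestor_le in Hts. lia.
  - destruct (Nat.eq_dec s 0) as [->|].
    { rewrite (digits_start t) in Hdig by assumption. rewrite digits_eq in Hdig. discriminate. }
    assert (Hs : 0 < s) by lia. pose proof (Hp s Hs) as Hps.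
    destruct (heavy s) eqn:Es.
    + assert (Hdig' : digits (p s) = digits t) by (rewrite <- (digits_heavy s); assumption).
      destruct (ancestor_inv v s Hvs) as [->|[_ Hvps]].
      (* Since s is heavy, p s survives as long as s, so by induction t lies below p s; its digits
         then force it below s. *)
      * apply (digits_off_path (p s)); try assumption; try reflexivity; [lia| |lia|congruence].
        apply (IH (p s + t) ltac:(lia) (p s)); try lia; [assumption|apply ancestor_refl|].
        apply Nat.eqb_eq in Es. lia.
      * apply (IH (p s + t) ltac:(lia) (p s)); try lia; assumption.
    + rewrite (digits_start t), (digits_start s) in Hdig by assumption.
      injection Hdig as Hd Hdig.
      pose proof (last_of_same_digit s t Ht Et ltac:(lia) HtN Hd) as Hlt.
      pose proof (last_ge s s (ancestor_refl s) ltac:(lia)).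
      destruct (ancestor_inv v s Hvs) as [->|[_ Hvps]]; [lia|].
      apply ancestor_step; [assumption|].
      apply (IH (p s + p t) ltac:(lia) (p s)); try lia; assumption.
Qed.

(** Digits at most l, shifted by one, fit base l + 2, and there are at most l + 1 of them. The
    descendant u shows that the subtree of v is alive at t. *)
Lemma exists_coloring : exists color : nat -> nat,
  (forall t, t <= N -> color t < (l + 2) ^ (l + 1)) /\
  (forall s t u v, s <= t -> t <= u -> u <= N -> color s = color t ->
     anc v s -> anc v u -> anc v t).
Proof.
  assert (HB : forall t, Forall (fun x => S x < l + 2) (digits t)).
  { intros t. eapply Forall_impl; [|apply digits_bound]. simpl; lia. }
  exists (fun t => encode (l + 2) (digits t)). split.
  - intros t Ht. eapply Nat.lt_le_trans; [apply encode_lt, HB|].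
    apply Nat.pow_le_mono_r; [lia|]. pose proof (length_digits t Ht). lia.
  - intros s t u v Hst Htu HuN E Hs Hu.
    apply encode_inj in E; [|apply HB|apply HB].
    apply (ancestor_of_same_digits s); try lia; try assumption.
    pose proof (last_ge v u Hu HuN). lia.
Qed.

End RequestTree.

(** * Finger moves *)

Lemma sum_below_indicator n a f :
  sum_below n (fun i => if i =? a then f i else 0) = if a <? n then f a else 0.
Proof.
  induction n as [|n IH]; [reflexivity|]. cbn [sum_below]. rewrite IH.
  destruct (Nat.ltb_spec a n), (Nat.ltb_spec a (S n)), (Nat.eqb_spec n a);
    subst; lia.
Qed.

Lemma sum_below_at_most_one n P :
  (forall s t, s < t -> t < n -> P s = true -> P t = true -> False) ->
  sum_below n (fun t => Nat.b2n (P t)) <= 1.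
Proof.
  induction n as [|n IH]; intros H; cbn [sum_below]; [lia|].
  destruct (P n) eqn:E; cbn [Nat.b2n].
  - enough (sum_below n (fun t => Nat.b2n (P t)) <= sum_below n (fun _ => 0))
      by (rewrite sum_below_const in *; lia).
    apply sum_below_le. intros i Hi. destruct (P i) eqn:E'; cbn [Nat.b2n]; [|lia].
    exfalso; apply (H i n); try lia; assumption.
  - assert (sum_below n (fun t => Nat.b2n (P t)) <= 1); [|lia].
    apply IH. intros s t Hst Ht. apply H; lia.
Qed.

(** Counting colour by colour, each of the K classes contributes at most 1. *)
Lemma sum_below_injective_on n K P (color : nat -> nat) :
  (forall t, t < n -> color t < K) ->
  (forall s t, s < t -> t < n -> color s = color t -> P s = true -> P t = true -> False) ->
  sum_below n (fun t => Nat.b2n (P t)) <= K.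
Proof.
  intros HK H.
  rewrite (sum_below_ext n _
    (fun t => sum_below K (fun f => Nat.b2n ((color t =? f) && P t)%bool))).
  - rewrite sum_below_swap.
    transitivity (sum_below K (fun _ => 1)); [|rewrite sum_below_const; lia].
    apply sum_below_le. intros f _.
    apply (sum_below_at_most_one n (fun t => ((color t =? f) && P t)%bool)).
    intros s t Hst Ht Hs Hs'. apply andb_prop in Hs as [Es Ps]. apply andb_prop in Hs' as [Et Pt].
    apply Nat.eqb_eq in Es, Et. apply (H s t); try assumption; congruence.
  - intros t Ht. rewrite (sum_below_ext K _ (fun f => if f =? color t then Nat.b2n (P t) else 0)).
    + rewrite sum_below_indicator. rewrite (proj2 (Nat.ltb_lt _ _) (HK t Ht)). reflexivity.
    + intros f _. rewrite Nat.eqb_sym. destruct (f =? color t); reflexivity.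
Qed.

(** The default 0 encodes the initial positions: every finger starts at the key of the first
    request. *)
Fixpoint previous (color : nat -> nat) (f t : nat) : nat :=
  match t with
  | 0 => 0
  | S t' => if color t' =? f then t' else previous color f t'
  end.

Lemma previous_lt color f t : 0 < t -> previous color f t < t.
Proof.
  destruct t as [|t]; [lia|]. intros _. cbn [previous].
  destruct (_ =? _); [lia|]. induction t as [|t IH]; cbn [previous]; [lia|].
  destruct (_ =? _); lia.
Qed.

Lemma previous_le color f t : previous color f t <= t.
Proof. destruct t as [|t]; [reflexivity|]. apply Nat.lt_le_incl, previous_lt; lia. Qed.

Lemma previous_color color f t : previous color f t = 0 \/ color (previous color f t) = f.
Proof.
  induction t as [|t IH]; [left; reflexivity|]. cbn [previous].
  destruct (Nat.eqb_spec (color t) f); [right; assumption|exact IH].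
Qed.

Lemma previous_ge color f s t : s < t -> color s = f -> s <= previous color f t.
Proof.
  induction t as [|t IH]; [lia|]. intros Hs E. cbn [previous].
  destruct (Nat.eqb_spec (color t) f); [lia|].
  apply IH; [|assumption]. destruct (Nat.eq_dec s t) as [->|]; [contradiction|lia].
Qed.

(* The sum bounds the length of the tree path from a to b. *)
Lemma bits_dist_tree_path l N p x a b :
  parent_within l p -> a <= N -> b <= N ->
  bits_dist (x a) (x b) <=
  sum_below (S N) (fun v =>
    bits_dist (x v) (x (p v)) * Nat.b2n (xorb (ancestor p v a) (ancestor p v b))).
Proof.
  intros Hp. remember (a + b) as k eqn:Hk. revert a b Hk.
  induction k as [k IH] using lt_wf_ind.
  (* The larger endpoint a is an ancestor of neither b nor p a, so replacing it by p a changes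
     ancestry only at v = a, where the edge from a to p a is charged. *)
  assert (Hlt : forall a b, a + b = k -> b < a -> a <= N ->
    bits_dist (x a) (x b) <=
    sum_below (S N) (fun v =>
      bits_dist (x v) (x (p v)) * Nat.b2n (xorb (ancestor p v a) (ancestor p v b)))).
  { intros a b Hk Hba HaN. pose proof (Hp a ltac:(lia)) as Hpa.
    etransitivity; [apply (bits_dist_triangle _ (x (p a)))|].
    specialize (IH (p a + b) ltac:(lia) (p a) b eq_refl ltac:(lia) ltac:(lia)).
    pose proof (sum_below_indicator (S N) a (fun v => bits_dist (x v) (x (p v)))) as Hind.
    cbn beta in Hind. rewrite (proj2 (Nat.ltb_lt a (S N))) in Hind by lia.
    rewrite <- Hind. etransitivity; [apply Nat.add_le_mono_l, IH|].
    rewrite <- sum_below_add. apply sum_below_le. intros v _.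
    destruct (Nat.eqb_spec v a) as [->|Hv].
    - assert (E1 : ancestor p a b = false).
      { destruct (ancestor p a b) eqn:E; [|reflexivity].
        apply (ancestor_le l p Hp) in E; lia. }
      assert (E2 : ancestor p a (p a) = false).
      { destruct (ancestor p a (p a)) eqn:E; [|reflexivity].
        apply (ancestor_le l p Hp) in E; lia. }
      rewrite E1, E2, (ancestor_refl l p Hp). cbn. lia.
    - rewrite (ancestor_parent l p Hp v a) by lia. lia. }
  intros a b Hk Ha Hb.
  destruct (lt_eq_lt_dec a b) as [[Hab|Hab]|Hab].
  - rewrite bits_dist_sym. etransitivity; [apply (Hlt b a); lia|].
    apply sum_below_le. intros v _. rewrite Bool.xorb_comm. reflexivity.
  - subst b. rewrite bits_dist_refl. lia.
  - apply Hlt; lia.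
Qed.

(* By convexity of the colour classes, each of them enters and leaves the subtree of
   descendants of v at most once. *)
Lemma finger_cost_le_tree_weight l N p x :
  parent_within l p -> p 0 = 0 ->
  exists color : nat -> nat,
    (forall t, t <= N -> color t < (l + 2) ^ (l + 1)) /\
    sum_below (S N) (fun t => bits_dist (x t) (x (previous color (color t) t))) <=
    2 * (l + 2) ^ (l + 1) * sum_below (S N) (fun v => bits_dist (x v) (x (p v))).
Proof.
  intros Hp Hp0. destruct (exists_coloring l N p Hp) as (color & HK & Hconv).
  exists color. split; [exact HK|].
  set (K := (l + 2) ^ (l + 1)) in *.
  set (prev t := previous color (color t) t).
  change (sum_below (S N) (fun t => bits_dist (x t) (x (prev t))) <=
    2 * K * sum_below (S N) (fun v => bits_dist (x v) (x (p v)))).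
  assert (Hprev : forall t, prev t <= t) by (intros; apply previous_le).
  assert (Hprev_ge : forall s t, s < t -> color s = color t -> s <= prev t)
    by (intros; apply previous_ge; assumption).
  assert (Hprev_color : forall t, prev t = 0 \/ color (prev t) = color t)
    by (intros; apply previous_color).
  clearbody prev.
  etransitivity; [apply sum_below_le with (g := fun t => sum_below (S N) (fun v =>
    bits_dist (x v) (x (p v)) * Nat.b2n (xorb (ancestor p v t) (ancestor p v (prev t)))))|].
  { intros t Ht. apply (bits_dist_tree_path l); [assumption|lia|]. specialize (Hprev t); lia. }
  rewrite sum_below_swap, <- sum_below_mul_l. apply sum_below_le. intros v HvN.
  rewrite sum_below_mul_l, (Nat.mul_comm (2 * K)).
  destruct (Nat.eq_dec v 0) as [->|Hv]; [rewrite Hp0, bits_dist_refl; lia|].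
  apply Nat.mul_le_mono_l.
  assert (Hv0 : forall t, ancestor p v t = true -> t <> 0).
  { intros t H ->. apply (ancestor_le l p Hp) in H; lia. }
  rewrite (sum_below_ext _ _ (fun t =>
    Nat.b2n (ancestor p v t && negb (ancestor p v (prev t)))%bool +
    Nat.b2n (negb (ancestor p v t) && ancestor p v (prev t))%bool))
    by (intros t _; destruct (ancestor p v t), (ancestor p v (prev t)); reflexivity).
  rewrite sum_below_add.
  enough (sum_below (S N) (fun t => Nat.b2n (ancestor p v t && negb (ancestor p v (prev t)))%bool) <= K
    /\ sum_below (S N) (fun t => Nat.b2n (negb (ancestor p v t) && ancestor p v (prev t))%bool) <= K)
    by lia.
  split.
  - apply (sum_below_injective_on (S N) K
      (fun t => (ancestor p v t && negb (ancestor p v (prev t)))%bool) color);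
      [intros; apply HK; lia|].
    (* Two entries at s < t: s <= prev t <= t with s and t below v, so prev t is below v by
       convexity. If prev t is the default 0, then s = 0, which is not below v. *)
    intros s t Hst Ht E Hs Ht'.
    apply andb_prop in Hs as [Hs _]. apply andb_prop in Ht' as [Ht1 Ht2].
    apply Bool.negb_true_iff in Ht2.
    rewrite (Hconv s (prev t) t v) in Ht2; try discriminate; try assumption;
      [apply Hprev_ge; assumption|apply Hprev|lia|].
    destruct (Hprev_color t) as [H0|H0]; [|congruence].
    pose proof (Hprev_ge s t Hst E). specialize (Hv0 s Hs). lia.
  - apply (sum_below_injective_on (S N) K
      (fun t => (negb (ancestor p v t) && ancestor p v (prev t))%bool) color);
      [intros; apply HK; lia|].
    (* Two exits at s < t: prev s <= s <= prev t with both ends below v, so s is below v as well. *)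
    intros s t Hst Ht E Hs Ht'.
    apply andb_prop in Hs as [Hs1 Hs2]. apply andb_prop in Ht' as [_ Ht2].
    apply Bool.negb_true_iff in Hs1.
    rewrite (Hconv (prev s) s (prev t) v) in Hs1; try discriminate; try assumption;
      [apply Hprev|apply Hprev_ge; assumption| |].
    + specialize (Hprev t); lia.
    + destruct (Hprev_color s) as [H0|H0]; [|assumption].
      exfalso; apply (Hv0 (prev s)); assumption.
Qed.

(** Invariant: before time t, finger f + 1 rests on the key last served with colour f. Adding the
    partial sum up to t on the left lets the induction run forward. *)
Lemma strat_cost_sum T x color K pos t k :
  (forall i, i < t + k -> color i < K) ->
  (forall f, f < K -> pos (S f) = x (previous color f t)) ->
  strat_cost T pos (map x (seq t k)) (map (fun i => S (color i)) (seq t k)) +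
  sum_below t (fun i => 1 + tree_dist T (x i) (x (previous color (color i) i))) =
  sum_below (t + k) (fun i => 1 + tree_dist T (x i) (x (previous color (color i) i))).
Proof.
  revert pos t; induction k as [|k IH]; intros pos t HK Hpos.
  - rewrite Nat.add_0_r. reflexivity.
  - cbn [seq map strat_cost]. rewrite Hpos by (apply HK; lia).
    replace (t + S k) with (S t + k) by lia. rewrite <- (IH (fun i => if i =? S (color t) then x t else pos i)).
    + cbn [sum_below]. lia.
    + intros i Hi; apply HK; lia.
    + intros f Hf. cbn [previous]. rewrite (Nat.eqb_sym (color t) f).
      cbn [Nat.eqb]. destruct (f =? color t); [reflexivity|apply Hpos, Hf].
Qed.

Lemma map_nth_seq (X : list nat) : map (fun i => nth i X 0) (seq 0 (length X)) = X.
Proof.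
  induction X as [|a X IH]; [reflexivity|]. cbn [length seq map nth]. f_equal.
  rewrite <- seq_shift, map_map. exact IH.
Qed.

Lemma exists_finger_strategy n K (X : list nat) color :
  Forall (fun x => 1 <= x <= n) X -> 0 < length X ->
  (forall t, t < length X -> color t < K) ->
  Fk_le K n X (INR (sum_below (length X) (fun t =>
    5 + 2 * bits_dist (nth t X 0) (nth (previous color (color t) t) X 0)))).
Proof.
  intros HX Hlen HK. set (x i := nth i X 0).
  assert (Hx : forall i, i < length X -> 1 <= x i <= n).
  { intros i Hi. apply (proj1 (Forall_forall _ _) HX), nth_In, Hi. }
  destruct (exists_tree_for_pairs n (length X) x (fun t => x (previous color (color t) t)))
    as (T & HT & Hcost).
  { intros i Hi. split; apply Hx; [exact Hi|].
    pose proof (previous_le color (color i) i); lia. }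
  exists T. split; [exact HT|].
  exists (repeat (x 0) K), (map (fun i => S (color i)) (seq 0 (length X))). split.
  - split; [apply repeat_length|split; [|split]].
    + apply Forall_forall. intros a Ha. apply repeat_spec in Ha as ->. apply Hx, Hlen.
    + rewrite length_map, length_seq. reflexivity.
    + apply Forall_forall. intros f Hf. apply in_map_iff in Hf as (i & <- & Hi).
      apply in_seq in Hi. specialize (HK i ltac:(lia)). lia.
  - apply le_INR. unfold kfinger_cost.
    rewrite <- (map_nth_seq X) at 1. fold x.
    pose proof (strat_cost_sum T x color K (fun i => nth (i - 1) (repeat (x 0) K) 0) 0 (length X)) as H.
    cbn [sum_below Nat.add] in H. rewrite Nat.add_0_r in H. rewrite H; [exact Hcost|exact HK|].
    intros f Hf. cbn [previous]. rewrite (nth_indep _ 0 (x 0)) by (rewrite repeat_length; lia).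
    apply nth_repeat.
Qed.

(** * Logarithms, minimising parents and the final constants *)

Open Scope R_scope.

Lemma ln_2_pos : 0 < ln 2.
Proof. rewrite <- ln_1. apply ln_increasing; lra. Qed.

Lemma ln_le_mono y z : 0 < y -> y <= z -> ln y <= ln z.
Proof.
  intros Hy [Hyz| ->]; [apply Rlt_le, ln_increasing; assumption|apply Rle_refl].
Qed.

Lemma log2m_ge_1 y : 1 <= log2m y.
Proof.
  unfold log2m. pose proof ln_2_pos.
  apply Rmult_le_reg_r with (ln 2); [assumption|].
  replace (ln (Rmax 2 y) / ln 2 * ln 2) with (ln (Rmax 2 y)) by (field; lra).
  rewrite Rmult_1_l. apply ln_le_mono; [lra|apply Rmax_l].
Qed.

(** The extra 1 in [bits] is absorbed by [log2m] being at least 1, whence the factor 2; the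
    working-set term r only enlarges the right side. *)
Lemma bits_le_log2m d r : INR (bits d) <= 2 * log2m (INR (d + r)).
Proof.
  pose proof (log2m_ge_1 (INR (d + r))).
  destruct (Nat.eq_dec d 0) as [->|Hd]; [simpl in *; lra|].
  rewrite bits_pos, S_INR by lia.
  enough (INR (Nat.log2 d) <= log2m (INR (d + r))) by lra.
  unfold log2m. pose proof ln_2_pos.
  apply Rmult_le_reg_r with (ln 2); [assumption|].
  replace (ln (Rmax 2 (INR (d + r))) / ln 2 * ln 2) with (ln (Rmax 2 (INR (d + r)))) by (field; lra).
  rewrite <- ln_pow by lra.
  apply ln_le_mono; [apply pow_lt; lra|].
  etransitivity; [|apply Rmax_r].
  destruct (Nat.log2_spec d ltac:(lia)) as [Hlog _].
  change 2 with (INR 2). rewrite <- pow_INR. apply le_INR. lia.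
Qed.

(** An informative existential, so that a minimising index can be extracted to define the parent
    function. *)
Lemma fold_left_Rmin_attained (g : nat -> R) L a :
  {t | In t (a :: L) & fold_left (fun acc t => Rmin acc (g t)) L (g a) = g t}.
Proof.
  revert a; induction L as [|b L IH]; intros a.
  - exists a; [left|]; reflexivity.
  - cbn [fold_left].
    assert (E : {Rmin (g a) (g b) = g a} + {Rmin (g a) (g b) = g b}).
    { unfold Rmin. destruct (Rle_dec (g a) (g b)); [left|right]; reflexivity. }
    destruct E as [->| ->].
    + destruct (IH a) as [t Ht Et]. exists t; [|exact Et].
      destruct Ht as [->|Ht]; [left; reflexivity|right; right; exact Ht].
    + destruct (IH b) as [t Ht Et]. exists t; [right; exact Ht|exact Et].
Qed.

Lemma ub_term_attained l n X i : (1 <= l)%nat -> (0 < i)%nat ->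
  {j | (j < i <= j + l)%nat & exists r,
     ub_term l n X (S i) = log2m (INR (natdist (nth i X 0%nat) (nth j X 0%nat) + r))}.
Proof.
  intros Hl Hi. destruct i as [|i]; [lia|].
  set (g t' := log2m (INR (natdist (Defs.xt X (S (S i))) (Defs.xt X t') + rho X (S (S i)) (Defs.xt X t')))).
  destruct (fold_left_Rmin_attained g
    (seq (S (Nat.max 1 (S (S i) - l))) (S (S i) - 1 - Nat.max 1 (S (S i) - l)))
    (Nat.max 1 (S (S i) - l))) as [t Ht Et].
  (* Request times start at 1, nodes at 0. *)
  exists (t - 1)%nat.
  - destruct Ht as [<-|Ht]; [|apply in_seq in Ht]; lia.
  - exists (rho X (S (S i)) (Defs.xt X t)). etransitivity; [exact Et|]. subst g. unfold Defs.xt.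
    replace (S (S i) - 1)%nat with (S i) by lia. reflexivity.
Qed.

Lemma exists_parent l n X : (1 <= l)%nat ->
  {p | parent_within l p /\ p 0%nat = 0%nat & forall i,
     1 <= ub_term l n X (S i) /\
     INR (bits_dist (nth i X 0%nat) (nth (p i) X 0%nat)) <= 2 * ub_term l n X (S i)}.
Proof.
  intros Hl.
  exists (fun i => match i with
                   | O => O
                   | S i' => let (j, _, _) := ub_term_attained l n X (S i') Hl (Nat.lt_0_succ i') in j
                   end).
  - split; [|reflexivity]. intros [|i] Hi; [lia|].
    destruct (ub_term_attained l n X (S i) Hl (Nat.lt_0_succ i)) as [j Hj _]. exact Hj.
  - intros [|i].
    + rewrite bits_dist_refl. pose proof (log2m_ge_1 (INR n)). simpl in *; lra.
    + destruct (ub_term_attained l n X (S i) Hl (Nat.lt_0_succ i)) as [j _ [r ->]].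
      split; [apply log2m_ge_1|apply bits_le_log2m].
Qed.

Lemma sum_below_le_fold c (g : nat -> nat) (f : nat -> R) t k :
  (forall i, INR (g i) <= c * f (S i)) ->
  INR (sum_below (t + k) g) <=
  INR (sum_below t g) + c * fold_right Rplus 0 (map f (seq (S t) k)).
Proof.
  intros H. revert t; induction k as [|k IH]; intros t.
  - rewrite Nat.add_0_r. simpl. lra.
  - replace (t + S k)%nat with (S t + k)%nat by lia. specialize (IH (S t)).
    cbn [sum_below seq map fold_right] in *. rewrite plus_INR in IH. specialize (H t). lra.
Qed.

Theorem theorem4 :
  exists alpha gamma : nat -> nat,
    forall l : nat, (1 <= l)%nat ->
    forall n m : nat, (1 <= n)%nat -> (n <= m)%nat ->
    forall X : list nat,
      length X = m -> Forall (fun x => 1 <= x <= n)%nat X ->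
      Fk_le (alpha l) n X (INR (gamma l) * UB l n X).
Proof.
  (* With K colours and edge weights w, the moves cost at most 5 + 2 (2 K w) per request on
     aggregate. Since w <= 2 u and 1 <= u for the term u of [UB], this is at most (5 + 8 K) u. *)
  exists (fun l => (l + 2) ^ (l + 1))%nat, (fun l => 5 + 8 * (l + 2) ^ (l + 1))%nat.
  intros l Hl n m Hn Hnm X Hlen HX.
  set (K := ((l + 2) ^ (l + 1))%nat).
  destruct (exists_parent l n X Hl) as [p [Hp Hp0] Hub].
  destruct (finger_cost_le_tree_weight l (m - 1) p (fun i => nth i X 0%nat) Hp Hp0)
    as (color & HK & Hcost). fold K in HK, Hcost.
  destruct (exists_finger_strategy n K X color HX) as (T & HT & init & fs & Hvalid & Hle);
    [lia|intros t Ht; apply HK; lia|].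
  exists T. split; [exact HT|]. exists init, fs. split; [exact Hvalid|].
  etransitivity; [exact Hle|].
  replace (S (m - 1)) with (length X) in Hcost by lia.
  set (w i := bits_dist (nth i X 0%nat) (nth (p i) X 0%nat)) in *.
  transitivity (INR (sum_below (0 + length X) (fun i => 5 + 4 * K * w i)%nat)).
  - apply le_INR. rewrite Nat.add_0_l, !sum_below_add, !sum_below_mul_l, sum_below_const. lia.
  - etransitivity; [apply (sum_below_le_fold (INR (5 + 8 * K)) _ (ub_term l n X))|].
    + intros i. destruct (Hub i) as [H1 H2]. fold (w i) in H2.
      rewrite !plus_INR, !mult_INR. pose proof (pos_INR K).
      replace (INR 5) with 5 by (simpl; lra). replace (INR 4) with 4 by (simpl; lra).
      replace (INR 8) with 8 by (simpl; lra). nra.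
    + unfold UB. cbn [sum_below INR]. lra.
Qed.
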